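(* Let $d\in\mathbb{Z}_{\ge1}$ and let $\mathfrak{q}=\{q_s\}_{s\ge0}\subset\mathbb{R}[x]_d$ be a $\boxplus_d$-semigroup. Then the finite free infinitesimal generator of $\mathfrak{q}$ satisfies $$\iota_d\bigl(\mathcal{L}[\mathfrak{q}]f\bigr)=\mathcal{L}^{(d)}\bigl[\iota_d(\mathfrak{q})\bigr]\bigl(\iota_d(f)\bigr),\qquad f\in\mathbb{R}[x]_d,$$ where $\iota_d(\mathfrak{q}):=\{\iota_d(q_s)\}_{s\ge0}\subset\operatorname{Im}\iota_d$ is a $\boxplus^d$-semigroup.
   Context: $(d)_{\underline{k}}=d(d-1)\cdots(d-k+1)$. $\mathbb{R}[x]_d$ is the space of real polynomials of degree at most $d$. For $f=\sum_{i=0}^da_ix^{d-i}$ and $g=\sum_{i=0}^db_ix^{d-i}$ in $\mathbb{R}[x]_d$ the finite free convolution is $(f\boxplus_dg)(x)=\sum_{k=0}^d\sum_{i+j=k}\frac{(d)_{\underline{k}}}{(d)_{\underline{i}}(d)_{\underline{j}}}a_ib_jx^{d-k}$. The map $\iota_d:\mathbb{R}[x]_d\to\mathbb{R}\llbracket z\rrbracket$ is $\iota_d(f)(z)=z^df(z^{-1})$; its image $\operatorname{Im}\iota_d$ is the space of polynomials in $z$ of degree at most $d$. For $A=\sum_{k=0}^da_kz^k$ and $B=\sum_{k=0}^db_kz^k$ in $\operatorname{Im}\iota_d$, $(A\boxplus^dB)(z)=\sum_{k=0}^d\sum_{i+j=k}\frac{(d)_{\underline{k}}}{(d)_{\underline{i}}(d)_{\underline{j}}}a_ib_jz^k$.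 A family $\mathfrak{q}=\{q_s\}_{s\ge0}\subset\mathbb{R}[x]_d$ is a $\boxplus_d$-semigroup if $q_0(x)=x^d$ and $q_{s_1}\boxplus_dq_{s_2}=q_{s_1+s_2}$ for all $s_1,s_2\ge0$. A family $\mathfrak{Q}=\{Q_s\}_{s\ge0}\subset\operatorname{Im}\iota_d$ is a $\boxplus^d$-semigroup if $Q_0=1$, $Q_{s_1}\boxplus^dQ_{s_2}=Q_{s_1+s_2}$ for all $s_1,s_2\ge0$, and $\|Q_s-1\|\to0$ as $s\to0^+$, where $\|\sum_{k=0}^da_kz^k\|=\sum_{k=0}^d\left|\frac{a_k}{(d)_{\underline{k}}}\right|r^k$ for a fixed $r>0$ (the choice of $r$ is immaterial, since $\operatorname{Im}\iota_d$ is finite-dimensional). The finite free infinitesimal generator of $\mathfrak{q}$ is $\mathcal{L}[\mathfrak{q}]f=\lim_{s\to0^+}\frac{f\boxplus_dq_s-f}{s}$ for $f\in\mathbb{R}[x]_d$, whenever the limit exists, and the $d$-deformed infinitesimal generator of $\mathfrak{Q}$ is $\mathcal{L}^{(d)}[\mathfrak{Q}]A=\lim_{s\to0^+}\frac{A\boxplus^dQ_s-A}{s}$ for $A\in\operatorname{Im}\iota_d$, whenever the limit exists.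
   Formalization: A semigroup q need not be continuous at 0 (e.g. q_s = exp(α(s))x^d, α discontinuous additive), so ι_d(q) is shown to satisfy the algebraic laws always, and to be a full ⊞^d-semigroup exactly when q_s → x^d as s → 0+, in particular when the generator exists at x^d. *)

(* Defs.v *)
From HB Require Import structures.
From mathcomp Require Import all_boot all_order all_algebra.
From mathcomp Require Import all_classical all_reals all_analysis.
Import Order.TTheory GRing.Theory Num.Theory numFieldNormedType.Exports.

Set Implicit Arguments.
Unset Strict Implicit.
Unset Printing Implicit Defensive.

Local Open Scope classical_set_scope.
Local Open Scope ring_scope.

(* R[x]_d and the image of iota_d are both the set of p : {poly R} with
   size p <= d.+1, in the variable x, resp. z. *)

Section FiniteFree.
Variable R : realType.

(* (d)_k / ((d)_i (d)_j) *)
Definition conv_weight (d k i j : nat) : R :=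
  (d ^_ k)%:R / ((d ^_ i)%:R * (d ^_ j)%:R).

(* f = \sum_i a_i x^(d - i), i.e. a_i = f`_(d - i). *)
Definition boxplus (d : nat) (f g : {poly R}) : {poly R} :=
  \sum_(k < d.+1) \sum_(i < d.+1) \sum_(j < d.+1 | (i + j == k)%N)
    (conv_weight d k i j * f`_(d - i) * g`_(d - j)) *: 'X^(d - k).

Definition boxplus_up (d : nat) (A B : {poly R}) : {poly R} :=
  \sum_(k < d.+1) \sum_(i < d.+1) \sum_(j < d.+1 | (i + j == k)%N)
    (conv_weight d k i j * A`_i * B`_j) *: 'X^k.

(* z^d f(1/z), which reverses the d.+1 coefficients of f; see iotaE. *)
Definition iota_poly (d : nat) (f : {poly R}) : {poly R} :=
  \poly_(k < d.+1) f`_(d - k).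

Lemma iotaE (d : nat) (f : {poly R}) (z : R) :
  (size f <= d.+1)%N -> z != 0 ->
  (iota_poly d f).[z] = z ^+ d * f.[z^-1].
Proof.
move=> sf z0; rewrite horner_poly (horner_coef_wide _ sf) mulr_sumr.
rewrite (reindex_inj rev_ord_inj) /=; apply: eq_bigr => i _.
have le_id : (i <= d)%N by rewrite -ltnS.
by rewrite subSS subKn // expfB_cond ?(negbTE z0) ?add0n // exprVn mulrCA.
Qed.

Definition dnorm (d : nat) (r : R) (A : {poly R}) : R :=
  \sum_(k < d.+1) `|A`_k / (d ^_ k)%:R| * r ^+ k.

(* Families are indexed by all of R; only the indices s >= 0 matter. *)
Definition is_semigroup (d : nat) (q : R -> {poly R}) : Prop :=
  [/\ forall s, 0 <= s -> (size (q s) <= d.+1)%N,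
      q 0 = 'X^d &
      forall s1 s2, 0 <= s1 -> 0 <= s2 ->
        boxplus d (q s1) (q s2) = q (s1 + s2)].

Definition is_algebraic_semigroup_up (d : nat) (Q : R -> {poly R}) : Prop :=
  [/\ forall s, 0 <= s -> (size (Q s) <= d.+1)%N,
      Q 0 = 1 &
      forall s1 s2, 0 <= s1 -> 0 <= s2 ->
        boxplus_up d (Q s1) (Q s2) = Q (s1 + s2)].

Definition is_semigroup_up (d : nat) (r : R) (Q : R -> {poly R}) : Prop :=
  is_algebraic_semigroup_up d Q /\
  dnorm d r (Q s - 1) @[s --> 0^'+] --> (0 : R).

(* Convergence as s -> 0+ in the finite-dimensional space R[x]_d, whose
   topology is that of coefficientwise convergence. *)
Definition poly_cvg_right0 (p : R -> {poly R}) (g : {poly R}) : Prop :=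
  forall k : nat, (p s)`_k @[s --> 0^'+] --> g`_k.

(* L[q] f exists and equals g *)
Definition is_generator (d : nat) (q : R -> {poly R}) (f g : {poly R}) : Prop :=
  (size g <= d.+1)%N /\
  poly_cvg_right0 (fun s => s^-1 *: (boxplus d f (q s) - f)) g.

(* L^(d)[Q] A exists and equals B; the limit is taken in the norm dnorm d r,
   which does not see the coefficients of degree > d. *)
Definition is_generator_up (d : nat) (r : R) (Q : R -> {poly R})
    (A B : {poly R}) : Prop :=
  (size B <= d.+1)%N /\
  dnorm d r (s^-1 *: (boxplus_up d A (Q s) - A) - B) @[s --> 0^'+] --> (0 : R).

End FiniteFree.

(* Main.v *)
Require Import Defs.
From HB Require Import structures.
From mathcomp Require Import all_boot all_order all_algebra.
From mathcomp Require Import all_classical all_reals all_analysis.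
Import Order.TTheory GRing.Theory Num.Theory numFieldNormedType.Exports.

Local Open Scope classical_set_scope.
Local Open Scope ring_scope.

(** Reversing the coefficients, [iota_poly d], is a linear involution of the
    polynomials of degree at most [d]; it sends ['X^(d - k)] to ['X^k], and
    [boxplus d] and [boxplus_up d] are given on these two bases by the same
    structure constants.  Hence it is an isomorphism of algebras
    ([iota_boxplus]), which gives the algebraic semigroup and turns the
    difference quotient of [q] at [f] into that of its image at [iota_poly d f]
    ([iota_diff_quotient]).

    What remains is that limits correspond.  On one side they are taken
    coefficientwise, on the other in the weighted l^1 norm [dnorm d r].  As [r]
    and the falling factorials [d ^_ k], [k <= d], are positive, this norm is
    equivalent to the sup norm of the coefficients of degree at most [d]
    ([cvg_dnorm0]), so that [iota_poly d] identifies the two notions of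
    convergence ([cvg_iota]).  Continuity at [0] and existence, value and
    uniqueness of generators are then all transported by this one
    equivalence.  Differentiability implies continuity: since [q 0 = 'X^d], the
    semigroup law gives [boxplus d 'X^d (q s) = q s], so that a generator at
    ['X^d] is a right derivative of [q] at [0]. *)

Section ReversalAndLimits.
Context {R : realType}.
Implicit Types (d k : nat) (r : R) (f g : {poly R}) (p : R -> {poly R}).

Lemma coef_iota d f k : (k <= d)%N -> (iota_poly d f)`_k = f`_(d - k).
Proof. by move=> kd; rewrite coef_poly ltnS kd. Qed.

Lemma size_iota d f : (size (iota_poly d f) <= d.+1)%N.
Proof. exact: size_poly. Qed.

Lemma iota_linear d : linear (@iota_poly R d).
Proof.
move=> a f g; apply/polyP => k; rewrite coefD coefZ !coef_poly.
by case: ifP => _; rewrite ?coefD ?coefZ// mulr0 addr0.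
Qed.

HB.instance Definition _ d :=
  GRing.isLinear.Build R {poly R} {poly R} _ (@iota_poly R d) (iota_linear d).

Lemma iotaK d f : (size f <= d.+1)%N -> iota_poly d (iota_poly d f) = f.
Proof.
move=> sf; apply/polyP => k; have [kd|dk] := leqP k d.
  by rewrite !coef_iota ?leq_subr// subKn.
by rewrite !nth_default// ?(leq_trans _ dk)// size_iota.
Qed.

Lemma iotaXn d k : (k <= d)%N -> iota_poly d 'X^(d - k) = 'X^k :> {poly R}.
Proof.
move=> kd; apply/polyP => n; have [nd|dn] := leqP n d.
  by rewrite coef_iota// !coefXn eqn_sub2lE.
rewrite nth_default ?(leq_trans (size_iota _ _))// coefXn.
by rewrite gtn_eqF// (leq_ltn_trans kd).
Qed.

Lemma iota_boxplus d f g :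
  iota_poly d (boxplus d f g) = boxplus_up d (iota_poly d f) (iota_poly d g).
Proof.
have le_d (i : 'I_d.+1) : (i <= d)%N by rewrite -ltnS.
rewrite raddf_sum /=; apply: eq_bigr => k _.
rewrite raddf_sum /=; apply: eq_bigr => i _.
rewrite raddf_sum /=; apply: eq_bigr => j _.
by rewrite linearZZ /= iotaXn// !coef_iota.
Qed.

Lemma size_boxplus d f g : (size (boxplus d f g) <= d.+1)%N.
Proof.
do 3!(apply: (leq_trans (size_sum _ _ _)); apply/bigmax_leqP => ? _).
by rewrite (leq_trans (size_scale_leq _ _))// size_polyXn ltnS leq_subr.
Qed.

Lemma iota_diff_quotient d f g (s : R) :
  iota_poly d (s^-1 *: (boxplus d f g - f)) =
  s^-1 *: (boxplus_up d (iota_poly d f) (iota_poly d g) - iota_poly d f).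
Proof. by rewrite linearZZ raddfB /= iota_boxplus. Qed.

Lemma size_diff_quotient d f g (s : R) : (size f <= d.+1)%N ->
  (size (s^-1 *: (boxplus d f g - f)) <= d.+1)%N.
Proof.
move=> sf; rewrite (leq_trans (size_scale_leq _ _))//.
by rewrite (leq_trans (size_polyD _ _))// geq_max size_polyN size_boxplus.
Qed.

(** The norm is a sum of the terms [w k * `|A`_k|] with positive weights
    [w k = r ^+ k / (d ^_ k)%:R]: it is small when all coefficients are, and
    conversely it dominates each of its terms. *)
Lemma cvg_dnorm0 d r p : 0 < r ->
  dnorm d r (p s) @[s --> 0^'+] --> (0 : R) <->
  forall k, (k <= d)%N -> (p s)`_k @[s --> 0^'+] --> (0 : R).
Proof.
move=> r0.
have term_ge0 (A : {poly R}) (i : nat) : 0 <= `|A`_i / (d ^_ i)%:R| * r ^+ i.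
  by rewrite mulr_ge0// exprn_ge0// ltW.
split=> [p0 k kd|p0].
  have c0 : (d ^_ k)%:R != 0 :> R by rewrite pnatr_eq0 -lt0n ffact_gt0.
  have rk0 : 0 < r ^+ k by rewrite exprn_gt0.
  have p0k : dnorm d r (p s) * ((d ^_ k)%:R / r ^+ k) @[s --> 0^'+] --> (0 : R).
    by rewrite -[X in _ --> X](mul0r ((d ^_ k)%:R / r ^+ k)); exact: cvgMl.
  apply: norm_cvg0; apply: (squeeze_cvgr _ (cvg_cst 0) p0k).
  apply: nearW => s; rewrite normr_ge0/= mulrA ler_pdivlMr//.
  have -> : `|(p s)`_k| * r ^+ k =
      `|(p s)`_k / (d ^_ k)%:R| * r ^+ k * (d ^_ k)%:R.
    by rewrite normrM normfV normr_nat mulrAC divfK.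
  rewrite ler_wpM2r// /dnorm.
  have kd1 : (k < d.+1)%N by [].
  by rewrite (bigD1 (Ordinal kd1))//= lerDl sumr_ge0.
rewrite [X in _ --> X](_ : 0 = \sum_(k < d.+1) 0 :> R); last by rewrite big1.
apply: cvg_big => [|k _].
  exact: pseudometric_normed_Zmodule.add_continuous.
rewrite -[X in _ --> X](mul0r (r ^+ k)); apply: cvgMr_tmp.
rewrite -[X in _ --> X](normr0 R) -[X in `|X|](mul0r (d ^_ k)%:R^-1).
by apply: cvg_norm; apply: cvgMr_tmp; apply: p0; rewrite -ltnS.
Qed.

(** Convergence of [p] also requires the coefficients of degree [> d] to
    converge, which [dnorm d r] does not see; they vanish for small [s] under
    the degree bound on [p]. *)
Lemma cvg_iota d r p g : 0 < r ->
  (\forall s \near 0^'+, (size (p s) <= d.+1)%N) -> (size g <= d.+1)%N ->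
  poly_cvg_right0 p g <->
  dnorm d r (iota_poly d (p s) - iota_poly d g) @[s --> 0^'+] --> (0 : R).
Proof.
move=> r0 sp sg.
rewrite (cvg_dnorm0 d r (fun s => iota_poly d (p s) - iota_poly d g) r0).
have coefE k s : (k <= d)%N ->
    (iota_poly d (p s) - iota_poly d g)`_k = (p s)`_(d - k) - g`_(d - k).
  by move=> kd; rewrite coefB !coef_iota.
split=> [pg k kd|pg k].
  by under eq_cvg do rewrite coefE//; exact/subr_cvg0.
have [kd|dk] := leqP k d.
  apply/subr_cvg0; have := pg (d - k)%N (leq_subr _ _).
  by under eq_cvg do rewrite coefE ?leq_subr// subKn//.
rewrite [g`_k]nth_default ?(leq_trans sg)//.
apply: cvg_near_cst; apply: filterS sp => s sps.
by rewrite nth_default// (leq_trans sps).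
Qed.

Lemma poly_cvg_right0_unique p f g :
  poly_cvg_right0 p f -> poly_cvg_right0 p g -> f = g.
Proof.
move=> pf pg; apply/polyP => k.
exact: (cvg_unique _ (pf k) (pg k)).
Qed.

(** For [s > 0], [p s - f] is [s] times the difference quotient, and the latter
    stays bounded. *)
Lemma poly_cvg_right0_of_quotient p f g :
  poly_cvg_right0 (fun s => s^-1 *: (p s - f)) g -> poly_cvg_right0 p f.
Proof.
move=> pfg k; apply/subr_cvg0.
have s0 : (s : R) @[s --> 0^'+] --> (0 : R) by exact/cvg_at_right_filter/cvg_id.
have : s * (s^-1 *: (p s - f))`_k @[s --> 0^'+] --> (0 : R).
  by rewrite -[X in _ --> X](mul0r g`_k); exact: cvgM.
apply: cvg_trans; apply: near_eq_cvg; near=> s => /=.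
by rewrite coefZ coefB mulVKf// gt_eqF.
Unshelve. all: by end_near. Qed.

(** The difference quotient has degree at most [d] as soon as [f] has, whatever
    [q] is, so the correspondence is one between arbitrary families. *)
Lemma generator_iota d r (q : R -> {poly R}) f g : 0 < r ->
  (size f <= d.+1)%N -> (size g <= d.+1)%N ->
  is_generator d q f g <->
  is_generator_up d r (fun s => iota_poly d (q s))
    (iota_poly d f) (iota_poly d g).
Proof.
move=> r0 sf sg; rewrite /is_generator /is_generator_up size_iota sg.
have sp : \forall s \near 0^'+,
    (size (s^-1 *: (boxplus d f (q s) - f)) <= d.+1)%N.
  by apply: nearW => s; exact: size_diff_quotient.
have := cvg_iota d r _ g r0 sp sg.
under [X in _ <-> X]eq_cvg do rewrite iota_diff_quotient.
by move=> H; split=> -[_ /H].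
Qed.

End ReversalAndLimits.

Theorem theorem4p8 (R : realType) (d : nat) (hd : (1 <= d)%N)
    (r : R) (hr : 0 < r) (q : R -> {poly R}) (hq : is_semigroup d q) :
  let Q := fun s : R => iota_poly d (q s) in
  [/\ is_algebraic_semigroup_up d Q,
      is_semigroup_up d r Q <-> poly_cvg_right0 q 'X^d,
      (exists g : {poly R}, is_generator d q 'X^d g) -> is_semigroup_up d r Q &
      forall f : {poly R}, (size f <= d.+1)%N ->
        ((exists g : {poly R}, is_generator d q f g) <->
         (exists B : {poly R}, is_generator_up d r Q (iota_poly d f) B)) /\
        (forall g B : {poly R},
           is_generator d q f g ->
           is_generator_up d r Q (iota_poly d f) B ->
           iota_poly d g = B)].
Proof.
have [q_size q0 qD] := hq => Q.
have sXd : (size ('X^d : {poly R}) <= d.+1)%N by rewrite size_polyXn.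
have iotaXd : iota_poly d 'X^d = 1 :> {poly R}.
  by rewrite -[X in 'X^X]subn0 iotaXn.
have Q_alg : is_algebraic_semigroup_up d Q.
  split=> [s _||s t s0 t0]; rewrite /Q; first exact: size_iota.
    by rewrite q0.
  by rewrite -iota_boxplus qD.
have Q_cvg : is_semigroup_up d r Q <-> poly_cvg_right0 q 'X^d.
  have q_size_near : \forall s \near 0^'+, (size (q s) <= d.+1)%N.
    by near=> s; apply: q_size.
  rewrite (cvg_iota d r q _ hr q_size_near sXd) iotaXd.
  by split=> [[]|].
split=> // [[g [_ qg]]|f sf].
  apply/Q_cvg/(poly_cvg_right0_of_quotient _ _ g) => k.
  have := qg k; apply: cvg_trans; apply: near_eq_cvg; near=> s => /=.
  by rewrite -q0 qD// add0r.
(* As [iota_poly d] is an involution, every [B] is [iota_poly d g] for a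
   suitable [g], here [g := iota_poly d B]. *)
have pullback B : is_generator_up d r Q (iota_poly d f) B ->
    is_generator d q f (iota_poly d B).
  move=> fB; have [sB _] := fB.
  by apply/(generator_iota d r) => //; rewrite ?size_iota// iotaK.
split.
  split=> [[g fg]|[B /pullback fB]]; last by exists (iota_poly d B).
  by exists (iota_poly d g); apply/generator_iota => //; case: fg.
move=> g B [_ fg] fB; have [_ fB'] := pullback B fB.
by rewrite (poly_cvg_right0_unique _ _ _ fg fB') iotaK//; case: fB.
Unshelve. all: by end_near. Qed.
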